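(* Let $p>1$, define $q$ by $p^{-1}+q^{-1}=1$, let $n\ge 1$, and let $\mathbf{R}_+=(0,\infty)$. Then for all $a,b\in\mathbf{R}_+^n$ the implication $$(a_1^q,\ldots,a_n^q)\prec(b_1^q,\ldots,b_n^q)\quad\Longrightarrow\quad\sum_{i=1}^n b_iY_i\le_{\mathrm{st}}\sum_{i=1}^n a_iY_i$$ holds in each of the following cases: (1) $Y_1,\ldots,Y_n$ are i.i.d. Weibull variables with parameter $p$, i.e. with density $f(y)=p\,y^{p-1}e^{-y^p}$, $y>0$; (2) $p=q=2$, and $Y_1,\ldots,Y_n$ are i.i.d. generalized Rayleigh variables with parameter $\nu\ge1$, i.e. with density $f(y)\propto y^{\nu-1}e^{-y^2/2}$, $y>0$.
   Context: Usual stochastic order: for real random variables $X,Y$, $X\le_{\mathrm{st}}Y$ means $\Pr(X>t)\le\Pr(Y>t)$ for all $t\in\mathbf{R}$. Majorization: for $a,b\in\mathbf{R}^n$, $a\prec b$ means (i) $\sum_{i=1}^n a_i=\sum_{i=1}^n b_i$ and (ii) $\sum_{i=k}^n a_{(i)}\le\sum_{i=k}^n b_{(i)}$ for $k=2,\ldots,n$, where $a_{(1)}\le\cdots\le a_{(n)}$ and $b_{(1)}\le\cdots\le b_{(n)}$ are the coordinates arranged in increasing order. *)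

(* Defs.v *)
From HB Require Import structures.
From mathcomp Require Import all_boot all_order all_algebra.
From mathcomp Require Import all_classical all_reals all_analysis.

Set Implicit Arguments.
Unset Strict Implicit.
Unset Printing Implicit Defensive.

Import Order.TTheory GRing.Theory Num.Theory.
Import numFieldNormedType.Exports.

Local Open Scope classical_set_scope.
Local Open Scope ring_scope.

Definition increasing_rearrangement (R : realType) (n : nat) (a : 'I_n -> R) :
    seq R :=
  sort <=%R (codom a).

(* Indices are 0-based: [(increasing_rearrangement a)`_i] is a_(i+1), and the
   sums starting at a_(k), k = 2, ..., n, are those starting at index
   1 <= k < n. *)
Definition majorized (R : realType) (n : nat) (a b : 'I_n -> R) : Prop :=
  \sum_(i < n) a i = \sum_(i < n) b i /\
  forall k : nat, (1 <= k < n)%N ->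
    \sum_(k <= i < n) (increasing_rearrangement a)`_i <=
    \sum_(k <= i < n) (increasing_rearrangement b)`_i.

Definition st_le (R : realType)
    (d : measure_display) (T : measurableType d) (P : probability T R)
    (d' : measure_display) (T' : measurableType d') (P' : probability T' R)
    (X : {RV P >-> R}) (Y : {RV P' >-> R}) : Prop :=
  forall t : R, (ccdf X t <= ccdf Y t)%E.

Definition mutually_independent (R : realType)
    (d : measure_display) (T : measurableType d) (P : probability T R)
    (I : finType) (Y : I -> {RV P >-> R}) : Prop :=
  forall (J : {set I}) (A : I -> set R), (forall i, measurable (A i)) ->
    P (\bigcap_(i in [set` J]) (Y i @^-1` A i)) =
    (\prod_(i in J) P (Y i @^-1` A i))%E.

Definition has_density (R : realType)
    (d : measure_display) (T : measurableType d) (P : probability T R)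
    (X : {RV P >-> R}) (f : R -> R) : Prop :=
  [/\ measurable_fun setT f,
      forall y, 0 <= f y &
      forall A : set R, measurable A ->
        distribution P X A = (\int[lebesgue_measure]_(y in A) (f y)%:E)%E].

Definition iid_with_density (R : realType)
    (d : measure_display) (T : measurableType d) (P : probability T R)
    (I : finType) (Y : I -> {RV P >-> R}) (f : R -> R) : Prop :=
  mutually_independent Y /\ forall i, has_density (Y i) f.

Definition weibull_pdf (R : realType) (p : R) (y : R) : R :=
  if 0 < y then p * y `^ (p - 1) * expR (- (y `^ p)) else 0.

Definition rayleigh_kernel (R : realType) (nu : R) (y : R) : R :=
  if 0 < y then y `^ (nu - 1) * expR (- (y ^+ 2 / 2)) else 0.

(* The constant [c] is the normalizing one: [has_density] forces the density
   to have total mass 1. *)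
Definition iid_generalized_rayleigh (R : realType)
    (d : measure_display) (T : measurableType d) (P : probability T R)
    (I : finType) (Y : I -> {RV P >-> R}) (nu : R) : Prop :=
  exists c : R, iid_with_density Y (fun y => c * rayleigh_kernel nu y).

(* Main.v *)
(* One transfer between two coordinates of the q-th powers at a time, and
   conditioning on the remaining summands, reduce the claim to two summands:
   the weights x^(1/q), y^(1/q) are replaced by a^(1/q), (x + y - a)^(1/q) with
   y <= a <= x.

   Weibull case: Y_i = Z_i^(1/p) with Z_i exponential.  Given Z_1 + Z_2 = s, Z_1
   is uniform on [0, s].  By Hoelder's inequality (u, z) |-> u^(1/q) z^(1/p) is
   jointly concave, so the interval of those z at which the weighted sum exceeds
   t contains, for the new weights, the convex combinations of the interval for
   the old weights and of its mirror image in [0, s]; hence it is not shorter.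

   Rayleigh case: the two weight vectors have the same Euclidean norm, so the
   two half planes {weighted sum > t} are exchanged by a reflection.  It
   preserves y_1^2 + y_2^2, and it decreases y_1 y_2 on the side of the more
   balanced vector. *)
Require Import Defs.
From HB Require Import structures.
From mathcomp Require Import all_boot all_order all_algebra.
From mathcomp Require Import all_classical all_reals all_analysis.
From mathcomp Require Import measurable_realfun ring lra.

Set Implicit Arguments.
Unset Strict Implicit.
Unset Printing Implicit Defensive.

Import Order.TTheory GRing.Theory Num.Theory.
Import numFieldNormedType.Exports.

Local Open Scope classical_set_scope.
Local Open Scope ring_scope.

(** * Invariance of Lebesgue integrals on the line and in the plane *)

Section lebesgue_invariance.
Local Open Scope ereal_scope.
Context {R : realType}.
Local Notation mu := (@lebesgue_measure R).

Lemma lebesgue_measure_translate (c : R) (A : set R) : measurable A ->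
  pushforward mu (+%R^~ c : _ -> measurableTypeR R) A = mu A.
Proof.
move=> mA.
have mc : measurable_fun [set: R] (+%R^~ c : _ -> measurableTypeR R).
  by apply: measurable_funD => //; exact: measurable_cst.
apply/esym/lebesgue_measure_unique => //= _ [[a b]] _ <-.
rewrite /pushforward /=.
rewrite (_ : _ @^-1` _ = `](a - c)%R, (b - c)%R]%classic); last first.
  by apply/seteqP; split=> x /=; rewrite !in_itv/= ltrBlDr lerBrDr.
rewrite !lebesgue_measure_itv/= !lte_fin ltrD2r.
by congr (if _ then _ else _); rewrite -!EFinD; congr EFin; ring.
Qed.

Lemma ge0_integral_translate (c : R) (f : R -> \bar R) :
  measurable_fun setT f -> (forall y, 0 <= f y) ->
  \int[mu]_y f (y + c)%R = \int[mu]_y f y.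
Proof.
move=> mf f0.
have mc : measurable_fun [set: R] (+%R^~ c : _ -> measurableTypeR R).
  by apply: measurable_funD => //; exact: measurable_cst.
transitivity (\int[pushforward mu (+%R^~ c : _ -> measurableTypeR R)]_y f y).
  by rewrite ge0_integral_pushforward.
by apply: eq_measure_integral => A mA _; exact: lebesgue_measure_translate.
Qed.

Lemma ge0_integral_opp (f : R -> \bar R) :
  measurable_fun setT f -> (forall y, 0 <= f y) ->
  \int[mu]_y f (- y)%R = \int[mu]_y f y.
Proof.
move=> mf f0.
transitivity (\int[pushforward mu (-%R : _ -> measurableTypeR R)]_y f y).
  by rewrite ge0_integral_pushforward.
by apply: eq_measure_integral => A mA _; exact: lebesgue_measureN.
Qed.

End lebesgue_invariance.

(* The orthogonal reflection in the line x = k y, in the sheared coordinates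
   (x - k y, y). *)
Definition reflect_across (R : realType) (k : R) (z : R * R) : R * R :=
  let u := z.1 - k * z.2 in
  let v := z.2 + 2 * k / (1 + k ^+ 2) * u in
  (- u + k * v, v).

Section plane_reflection.
Local Open Scope ereal_scope.
Context {R : realType}.
Local Notation mu := (@lebesgue_measure R).

Lemma lebesgue_tonelli (f : R * R -> \bar R) :
  measurable_fun setT f -> (forall z, 0 <= f z) ->
  \int[mu]_x \int[mu]_y f (x, y) = \int[mu]_y \int[mu]_x f (x, y).
Proof.
by move=> mf f0; exact: (@fubini_tonelli _ _ (measurableTypeR R)
  (measurableTypeR R) R mu mu f).
Qed.

(* In coordinates where the mirror is an axis, the reflection is a sign change
   followed by a shear, so Tonelli and the one-dimensional invariances of the
   Lebesgue measure suffice. *)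
Lemma ge0_integral2_reflect (k : R) (phi : R * R -> \bar R) :
  measurable_fun setT phi -> (forall z, 0 <= phi z) ->
  \int[mu]_x \int[mu]_y phi (reflect_across k (x, y)) =
  \int[mu]_x \int[mu]_y phi (x, y).
Proof.
move=> mphi phi0.
pose m : R := (2 * k / (1 + k ^+ 2))%R.
(* [phi] after the reflection equals [psi] after the shear z.1 - k z.2. Each of the three shears
   involved disappears by a translation of one variable while the other is fixed. *)
pose chi (z : R * R) := phi ((z.1 + k * z.2)%R, z.2).
pose psi (z : R * R) := chi ((- z.1)%R, (z.2 + m * z.1)%R).
have mchi : measurable_fun setT chi.
  apply: measurableT_comp => //; apply: measurable_fun_pair => //=.
  by apply: measurable_funD => //; apply: measurable_funM.
have mpsi : measurable_fun setT psi.
  apply: measurableT_comp => //; apply: measurable_fun_pair => //=.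
    exact: measurableT_comp.
  by apply: measurable_funD => //; apply: measurable_funM.
have mrefl : measurable_fun setT (phi \o reflect_across k).
  rewrite (_ : _ \o _ = psi \o (fun z => ((z.1 - k * z.2)%R, z.2))) //.
  apply: measurableT_comp => //; apply: measurable_fun_pair => //=.
  by apply: measurable_funB => //; apply: measurable_funM.
transitivity (\int[mu]_y \int[mu]_x (phi \o reflect_across k) (x, y)).
  exact: (lebesgue_tonelli mrefl (fun z => phi0 _)).
transitivity (\int[mu]_y \int[mu]_x psi (x, y)).
  apply: eq_integral => y _.
  rewrite -(ge0_integral_translate (- (k * y))%R (f := fun x => psi (x, y))) //.
  - exact/measurableT_comp.
  - by move=> x; exact: phi0.
etransitivity; first exact: (esym (lebesgue_tonelli mpsi (fun z => phi0 _))).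
transitivity (\int[mu]_x \int[mu]_y chi ((- x)%R, y)).
  apply: eq_integral => x _.
  rewrite -(ge0_integral_translate (m * x)%R
    (f := fun y => chi ((- x)%R, y))) //.
  - exact/measurableT_comp.
  - by move=> y; exact: phi0.
rewrite (ge0_integral_opp (f := fun x => \int[mu]_y chi (x, y))); first last.
- by move=> x; apply: integral_ge0 => y _; exact: phi0.
- by apply: measurable_fun_fubini_tonelli_F => // z; exact: phi0.
etransitivity; first exact: (lebesgue_tonelli mchi (fun z => phi0 _)).
etransitivity; last exact: (esym (lebesgue_tonelli mphi phi0)).
apply: eq_integral => y _.
rewrite -(ge0_integral_translate (k * y)%R (f := fun x => phi (x, y))) //.
exact/measurableT_comp.
Qed.

End plane_reflection.

(** * Integration against a law given by a density *)

Section density.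
Local Open Scope ereal_scope.
Context {R : realType}.
Local Notation mu := (@lebesgue_measure R).

Import HBNNSimple.

(** Monotone convergence along simple functions [h n] increasing to [phi]. For a simple function,
    the claim is the hypothesis on [nu] applied to its level sets. *)
Lemma ge0_integral_density (nu : {measure set R -> \bar R}) (f : R -> R)
    (phi : R -> \bar R) :
  measurable_fun setT f -> (forall y, (0 <= f y)%R) ->
  (forall A, measurable A -> nu A = \int[mu]_(y in A) (f y)%:E) ->
  measurable_fun setT phi -> (forall y, 0 <= phi y) ->
  \int[nu]_y phi y = \int[mu]_y (phi y * (f y)%:E).
Proof.
move=> mf f0 nuE mphi phi0.
have mEf : measurable_fun setT (EFin \o f) by exact/measurable_EFinP.
pose h := nnsfun_approx measurableT mphi.
have mh n : measurable_fun setT (EFin \o h n) by exact/measurable_EFinP.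
have ndh y : {homo (fun n => (h n y)%:E) : m n / (m <= n)%N >-> m <= n}.
  by move=> m n mn; rewrite lee_fin; exact/lefP/nd_nnsfun_approx.
have hphi y : phi y = limn (fun n => (h n y)%:E).
  by apply/esym/cvg_lim => //; exact: cvg_nnsfun_approx.
transitivity (limn (fun n => \int[nu]_y (h n y)%:E)).
  rewrite -monotone_convergence//=; first by apply: eq_integral => y _.
  by move=> n y _; rewrite lee_fin.
transitivity (limn (fun n => \int[mu]_y ((h n y)%:E * (f y)%:E))); last first.
  rewrite -monotone_convergence//=; last 3 first.
  - by move=> n; apply: emeasurable_funM => //; exact: mh.
  - by move=> n y _; rewrite mule_ge0 ?lee_fin.
  - by move=> y _ m n mn; rewrite lee_wpmul2r ?lee_fin//; exact: ndh.
  apply: eq_integral => y _; rewrite hphi muleC -limeMl //.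
    by congr (limn _); apply/funext => n; rewrite muleC.
  by apply/ereal_nondecreasing_is_cvgn; exact: ndh.
congr (limn _); apply/funext => n /=.
have mind r : measurable_fun setT (fun y => (r * \1_(h n @^-1` [set r]) y)%:E).
  by apply/measurable_EFinP; exact: measurable_funM.
have ind0 r y : (0 <= r * \1_(h n @^-1` [set r]) y)%R.
  rewrite indicE; case: (boolP (y \in _)) => [/set_mem/= <-|_].
    by rewrite mulr1.
  by rewrite mulr0.
under eq_integral do rewrite fimfunE -fsumEFin//.
rewrite ge0_integral_fsum//; last first.
  by move=> r y _; rewrite lee_fin ind0.
under [RHS]eq_integral.
  move=> y _; rewrite fimfunE -fsumEFin// muleC ge0_mule_fsumr; last first.
    by move=> r; rewrite lee_fin ind0.
  over.
rewrite ge0_integral_fsum//; last 2 first.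
- by move=> r; apply: emeasurable_funM => //; exact: mind.
- by move=> r y _; rewrite mule_ge0 ?lee_fin// ind0.
apply: eq_fsbigr => r _.
rewrite integralZl_indic_nnsfun // integral_indic // setIT nuE //.
under [RHS]eq_integral do rewrite EFinM muleCA.
have [->|r0] := eqVneq r 0%R.
  by under [RHS]eq_integral do rewrite mul0e; rewrite mul0e integral0.
(* The sign of [r] is known only if [r] is a value of [h n]; an empty level set contributes 0 to
   both sides. *)
have [->|/set0P [y0 hy0]] := eqVneq (h n @^-1` [set r]) set0.
  rewrite integral_set0 mule0; under eq_integral do rewrite indic0 mule0 mule0.
  by rewrite integral0.
have r_ge0 : (0 <= r)%R by rewrite -hy0.
have mr1 : measurable_fun setT (fun y => (\1_(h n @^-1` [set r]) y : R)%:E).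
  by apply/measurable_EFinP; exact: measurable_indic.
rewrite ge0_integralZl_EFin //; last 2 first.
- by move=> y _; rewrite mule_ge0 ?lee_fin.
- by apply: emeasurable_funM => //; exact: mr1.
congr (_ * _); rewrite [LHS]integral_mkcond; apply: eq_integral => y _ /=.
by rewrite patchE indicE; case: ifP => _; rewrite ?mule1 ?mule0.
Qed.

End density.

(** * Tail probabilities as iterated integrals *)

Section weighted_tail.
Local Open Scope ereal_scope.
Context {R : realType}.
Implicit Types (nu : {sigma_finite_measure set R -> \bar R}) (s : seq R).

(* Pr (\sum_k s`_k Y_k > t) for independent Y_k of law nu. *)
Fixpoint weighted_tail nu s (t : R) : \bar R :=
  if s is c :: s' then \int[nu]_y weighted_tail nu s' (t - c * y)%R
  else (\1_`]-oo, 0%R[ t)%:E.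

Lemma weighted_tail_ge0 nu s t : 0 <= weighted_tail nu s t.
Proof.
elim: s t => [|c s IHs] t /=; first by rewrite lee_fin.
by apply: integral_ge0 => y _; exact: IHs.
Qed.

Lemma measurable_weighted_tail nu s : measurable_fun setT (weighted_tail nu s).
Proof.
elim: s => [|c s IHs] /=.
  by apply/measurable_EFinP; apply: measurable_indic.
apply: (measurable_fun_fubini_tonelli_F (m2 := nu)
  (fun z : R * R => weighted_tail nu s (z.1 - c * z.2)%R)).
  apply: measurableT_comp => //.
  by apply: measurable_funB => //; apply: measurable_funM.
by move=> z; exact: weighted_tail_ge0.
Qed.

Lemma weighted_tail_swap nu c c' s t :
  weighted_tail nu (c :: c' :: s) t = weighted_tail nu (c' :: c :: s) t.
Proof.
rewrite /=.
rewrite (fubini_tonelli (m1 := nu) (m2 := nu)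
  (fun z : R * R => weighted_tail nu s (t - c * z.1 - c' * z.2)%R)) /=.
- apply: eq_integral => y _; apply: eq_integral => x _.
  congr weighted_tail; ring.
- apply: measurableT_comp => //; first exact: measurable_weighted_tail.
  apply: measurable_funB; last by apply: measurable_funM.
  by apply: measurable_funB => //; apply: measurable_funM.
- by move=> z; exact: weighted_tail_ge0.
Qed.

(** Adjacent swaps bring any entry to the front. Hence any two coordinates can serve as the last two
    in a transfer. *)
Lemma weighted_tail_perm nu s s' t :
  perm_eq s s' -> weighted_tail nu s t = weighted_tail nu s' t.
Proof.
have front s1 s2 x u :
    weighted_tail nu (s1 ++ x :: s2) u = weighted_tail nu (x :: s1 ++ s2) u.
  elim: s1 u => [//|z s1 IHs1] u.
  rewrite cat_cons [RHS]weighted_tail_swap.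
  by apply: eq_integral => y _; exact: IHs1.
elim: s s' t => [|x s IHs] s' t; first by rewrite perm_sym => /perm_nilP ->.
move=> xss'; have : x \in s' by rewrite -(perm_mem xss') mem_head.
move=> /splitPr xs'; case: xs' xss' => s1 s2.
rewrite perm_sym (perm_catCA s1 [:: x]) /= perm_cons perm_sym => ss12.
by rewrite front; apply: eq_integral => y _; exact: IHs.
Qed.

(** Conditioning on the summands with weights in [r]: these are the outer integrals, and integration
    is monotone. *)
Lemma weighted_tail_cat_le nu r s s' :
  (forall t, weighted_tail nu s t <= weighted_tail nu s' t) ->
  forall t, weighted_tail nu (r ++ s) t <= weighted_tail nu (r ++ s') t.
Proof.
move=> ss'; elim: r => [//|c r IHr] t /=.
have mt s0 : measurable_fun setT (fun y => weighted_tail nu s0 (t - c * y)%R).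
  apply: measurableT_comp; first exact: measurable_weighted_tail.
  by apply: measurable_funB => //; apply: measurable_funM.
by apply: ge0_le_integral => // y _; exact: weighted_tail_ge0.
Qed.

End weighted_tail.

(** * Sums of independent variables *)

Section independent_sum.
Local Open Scope ereal_scope.
Context {R : realType} d (T : measurableType d) (P : probability T R).
Context (I : finType) (Y : I -> {RV P >-> R}) (c : I -> R).
Hypothesis indY : mutually_independent Y.

Let W (r : seq I) : {RV P >-> R} := (\sum_(i <- r) c i *: Y i)%R.

Let W_cons i r w : W (i :: r) w = (W r w + c i * Y i w)%R.
Proof. by rewrite /W big_cons addrC. Qed.

Let event (J : {set I}) (A : I -> set R) : set T :=
  \bigcap_(i in [set` J]) (Y i @^-1` A i).

Let measurable_event J A :
  (forall i, measurable (A i)) -> measurable (event J A).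
Proof.
move=> mA; apply: fin_bigcap_measurable => //.
by move=> i _; rewrite -[X in measurable X]setTI; exact: measurable_funPT.
Qed.

Let event_setU1 (J : {set I}) (A : I -> set R) (i : I) (B : set R) :
  i \notin J ->
  event (i |: J) (fun j => if j == i then B else A j) =
  Y i @^-1` B `&` event J A.
Proof.
move=> iJ; apply/seteqP; split => [w wE|w [wB wE] j /=].
  split; first by have /= := wE i; rewrite eqxx; apply; rewrite !inE eqxx.
  move=> j /= jJ; have /= := wE j; rewrite !inE jJ orbT => /(_ isT).
  by case: eqVneq => // ji; rewrite -ji jJ in iJ.
rewrite !inE; case: eqVneq => [-> //|_ /= jJ]; exact: wE.
Qed.

Let P_event_setU1 (J : {set I}) (A : I -> set R) (i : I) (B : set R) :
  (forall j, measurable (A j)) -> measurable B ->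
  i \notin J -> P (Y i @^-1` B `&` event J A) = P (Y i @^-1` B) * P (event J A).
Proof.
move=> mA mB iJ; rewrite -event_setU1 // indY; last by move=> j; case: eqP.
rewrite big_setU1 //= eqxx indY //; congr (_ * _).
by apply: eq_bigr => j jJ; case: eqVneq => // ji; rewrite -ji jJ in iJ.
Qed.

(* [W r] is independent of the sigma-algebra of the [Y i], [i] outside [r]; the
   events [event J A] form a generating pi-system of it. *)
Let sum_independent (r : seq I) :=
  forall (J : {set I}) (A : I -> set R) (B : set R),
  {in r, forall i, i \notin J} -> (forall i, measurable (A i)) ->
  measurable B ->
  P (W r @^-1` B `&` event J A) = P (W r @^-1` B) * P (event J A).

(** With the event on [J] fixed, both sides are measures in [S]. They agree on rectangles by
    independence, and rectangles determine the product measure. *)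
Let law_pair (r : seq I) i (J : {set I}) (A : I -> set R) (S : set (R * R)) :
  sum_independent r -> i \notin r -> {in i :: r, forall j, j \notin J} ->
  (forall j, measurable (A j)) -> measurable S ->
  P ((fun w => (W r w, Y i w)) @^-1` S `&` event J A) =
  P (event J A) * (distribution P (W r) \x distribution P (Y i)) S.
Proof.
move=> indW ir irJ mA mS.
have iJ : i \notin J by apply: irJ; rewrite mem_head.
have mE := measurable_event J mA.
have [p pE] : exists p : {nonneg R}, p%:num%:E = P (event J A).
  exists (NngNum (fine_ge0 (measure_ge0 P (event J A)))).
  by rewrite /= fineK // fin_num_measure.
pose Z w := (W r w, Y i w).
have mZ : measurable_fun setT Z by apply: measurable_fun_pair.
transitivity ((mscale p (distribution P (W r)) \x distribution P (Y i)) S);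
  last first.
  rewrite /product_measure1 ge0_integral_mscale // ?pE //.
  exact: measurable_fun_xsection.
pose m' := pushforward (mrestr P mE) Z.
rewrite (@product_measure_unique _ _ _ _ _ _ _ m') // => B C mB mC.
transitivity (P (event J A) * P (W r @^-1` B) * P (Y i @^-1` C)); last first.
  by rewrite -pE.

(* The condition that [Y i] lies in [C] joins the event on [J], so the independence of [W r] covers
   both at once. *)
pose A' j := if j == i then C else A j.
have mA' j : measurable (A' j) by rewrite /A'; case: eqP.
transitivity (P (W r @^-1` B `&` event (i |: J) A')).
  congr (P _); rewrite event_setU1 //; apply/seteqP; split => w /=.
    by move=> [[WB YC] wE].
  by move=> [WB [YC wE]].
rewrite indW // => [|j jr]; last first.
  rewrite !inE negb_or irJ ?inE ?jr ?orbT // andbT.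
  by apply: contraNneq ir => <-.
rewrite event_setU1 // P_event_setU1 //= /distribution /pushforward.
by rewrite [LHS]muleCA [LHS]muleC [X in X * _ = _]muleC.
Qed.

Let preimage_W_cons i r B : W (i :: r) @^-1` B =
  (fun w => (W r w, Y i w)) @^-1` [set z | B (z.1 + c i * z.2)%R].
Proof. by apply/seteqP; split => w /=; rewrite W_cons. Qed.

Let measurable_add_scaled i (B : set R) :
  measurable B -> measurable [set z : R * R | B (z.1 + c i * z.2)%R].
Proof.
move=> mB; rewrite -[X in measurable X]setTI.
have : measurable_fun setT (fun z : R * R => (z.1 + c i * z.2)%R).
  by apply: measurable_funD => //; apply: measurable_funM.
exact.
Qed.

Let event_set0 (A : I -> set R) : event finset.set0 A = setT.
Proof. by apply/seteqP; split => // w _ j /=; rewrite inE. Qed.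

Let law_W_cons (r : seq I) i (S : set (R * R)) :
  sum_independent r -> i \notin r -> measurable S ->
  P ((fun w => (W r w, Y i w)) @^-1` S) =
  (distribution P (W r) \x distribution P (Y i)) S.
Proof.
move=> indW ir mS; have := @law_pair r i finset.set0 (fun=> setT) S indW ir.
rewrite event_set0 setIT probability_setT mul1e; apply => //.
by move=> j _; rewrite inE.
Qed.

Let sum_independentP (r : seq I) : uniq r -> sum_independent r.
Proof.
elim: r => [_ J A B _ mA mB|i r IHr /= /andP[ir ur] J A B irJ mA mB].
  (* The empty sum is constantly 0, so each of its events is empty or everything. *)
  have -> : W [::] @^-1` B = if `[< B 0%R >] then setT else set0.
    apply/seteqP; split => w /=; rewrite /W big_nil /=;
      by case: ifPn => [/asboolP|/asboolPn].
  case: ifP => _; first by rewrite setTI probability_setT mul1e.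
  by rewrite set0I measure0 mul0e.
have {}IHr := IHr ur.
rewrite preimage_W_cons law_pair //; last exact: measurable_add_scaled.
by rewrite law_W_cons // 1?muleC //; exact: measurable_add_scaled.
Qed.

Lemma ccdf_weighted_sum (nu : {sigma_finite_measure set R -> \bar R})
    (r : seq I) t :
  uniq r -> (forall i A, measurable A -> distribution P (Y i) A = nu A) ->
  ccdf (\sum_(i <- r) c i *: Y i : {RV P >-> R})%R t =
  weighted_tail nu [seq c i | i <- r] t.
Proof.
move=> + Ynu; rewrite -/(W r); elim: r t => [|i r IHr] t /=.
  move=> _; rewrite /ccdf /distribution /pushforward /=.
  rewrite indicE /= mem_setE in_itv /=.
  case: ltP => t0.
    rewrite (_ : _ @^-1` _ = setT) ?probability_setT //.
    by apply/seteqP; split => // w _ /=; rewrite /W big_nil in_itv /= t0.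
  rewrite (_ : _ @^-1` _ = set0) ?measure0 //.
  by apply/seteqP; split => // w /=; rewrite /W big_nil in_itv /= ltNge t0.
move=> /andP[ir ur].
rewrite /ccdf /distribution /pushforward preimage_W_cons.
have mray : measurable `]t, +oo[ by [].
have mS := measurable_add_scaled i mray.
rewrite law_W_cons //; last exact: sum_independentP.
(* The recursion of [weighted_tail] fixes the value of [Y i] outside, so the product measure is
   rewritten with the second factor integrated last. *)
rewrite (@product_measure_unique _ _ _ _ _ _ _
  (distribution P (W r) \x^ distribution P (Y i))) //; last first.
  by move=> B C mB mC; exact: product_measure2E.
rewrite /product_measure2.
transitivity (\int[distribution P (Y i)]_y ccdf (W r) (t - c i * y)%R).
  apply: eq_integral => y _ /=; rewrite /ccdf; congr (distribution P (W r) _).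
  apply/seteqP; split => w;
    by rewrite /ysection /= inE /= !in_itv /= !andbT ltrBlDr.
transitivity (\int[distribution P (Y i)]_y
    weighted_tail nu [seq c i | i <- r] (t - c i * y)%R).
  by apply: eq_integral => y _; rewrite IHr.
by apply: eq_measure_integral => B mB _; exact: Ynu.
Qed.

End independent_sum.

(** * Majorization as a chain of transfers between two coordinates *)

Section majorization.
Context {R : realType}.
Implicit Types (s r : seq R) (e : R).

(* For s and s' of equal length, every partial sum of s' plus e dominates the
   corresponding one of s, with equality at the end. *)
Fixpoint dominated e s s' : Prop :=
  match s, s' with
  | [::], [::] => e = 0
  | x :: s1, x' :: s1' => 0 <= e + x' - x /\ dominated (e + x' - x) s1 s1'
  | _, _ => False
  end.

(** The slack is nonnegative before the last entry and zero after it, so the last entry of the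
    second list is at most that of the first. *)
Lemma dominated_last_le e M x s x' s' :
  0 <= e -> all (<= M) (x :: s) -> dominated e (x :: s) (x' :: s') ->
  last x' s' <= M.
Proof.
elim: s e x x' s' => [|y s IHs] e x x' s' e0 /= /andP[xM sM] [e1].
  by case: s' => //= eE; lra.
by case: s' => [[]|y' s' eE] //=; exact: IHs eE.
Qed.

(* Deleting the leading entry a of the first list shifts it by one index against
   r; since c <= a, the slack e + a - c is no smaller than before, and past x and
   y it coincides with the old one. *)
Lemma dominated_transfer e c s a x y r r' :
  all (<= a) (c :: s) -> dominated e (c :: s) (r ++ x :: y :: r') ->
  dominated (e + a - c) s (r ++ (x + y - a) :: r').
Proof.
elim: r e c s => [|b r IHr] e c s /= /andP[ca sa].
  case: s sa => [|d s] /= sa [e0 []] // e1 H.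
  have -> : e + a - c + (x + y - a) - d = e + x - c + y - d by ring.
  by split.
move=> [e0]; case: s sa => [|d s] /= sa H; first by case: (r) H.
have := IHr _ _ _ sa H.
have -> : e + b - c + a - d = e + a - c + b - d by ring.
by move=> H'; split=> //; move: sa => /andP[da _]; lra.
Qed.

(** Scanning for the first entry after [b] that is at most [a] yields the two coordinates between
    which the transfer takes place. *)
Lemma crossing_split (a b : R) s : a <= b -> s != [::] -> last b s <= a ->
  exists r x y r', b :: s = r ++ x :: y :: r' /\ y <= a <= x.
Proof.
elim: s b => [//|c s IHs] b ab _ /= la.
have [ca|/ltW ac] := leP c a.
  by exists [::], b, c, s; rewrite ca ab.
have [s0|s0] := eqVneq s [::].
  by exists [::], b, c, s; split => //; rewrite ab andbT; move: la; rewrite s0.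
have [r [x [y [r' [-> xy]]]]] := IHs c ac s0 la.
by exists (b :: r), x, y, r'.
Qed.

(** Induction on [s], whose head [a] is its largest entry. Two adjacent entries [x], [y] of [s']
    straddle [a], and replacing them by [a], [x + y - a] makes [a] common to both lists. It then
    moves to the prefix [r] of settled entries, and [dominated_transfer] handles the rest. The
    second list may lose its order, but [dominated] compares prefixes as they stand. *)
Lemma dominated_le (Phi : seq R -> \bar R) :
  (forall s s', perm_eq s s' -> Phi s = Phi s') ->
  (forall r (x a y : R), all (> 0) r -> 0 < y -> y <= a -> a <= x ->
     (Phi (r ++ [:: x; y]) <= Phi (r ++ [:: a; (x + y - a)%R]))%E) ->
  forall s s' r, sorted >=%R s -> all (> 0) s' -> all (> 0) r ->
    dominated 0 s s' -> (Phi (r ++ s') <= Phi (r ++ s))%E.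
Proof.
move=> Phi_perm Phi_transfer; elim=> [|a s IHs] [|b s'] r //=.
move=> sa /andP[b0 s'0] r0 [].
rewrite add0r subr_ge0 => ab dom.
have a_max : all (<= a) (a :: s).
  rewrite /= lexx /=; apply: order_path_min sa => x y z yx zx.
  exact: le_trans zx yx.
have [s'E|s'N] := eqVneq s' [::].
  move: dom; rewrite s'E; case: (s) => //= /eqP; rewrite subr_eq0 => /eqP->.
  exact: lexx.
have dom0 : dominated 0 (a :: s) (b :: s') by rewrite /= add0r subr_ge0.
have la := dominated_last_le (lexx 0) a_max dom0.
have [r1 [x [y [r2 [bs'E /andP[ya ax]]]]]] := crossing_split ab s'N la.
move: dom0; rewrite bs'E => /(dominated_transfer a_max).
rewrite add0r subrr => dom1.
have : all (> 0) (b :: s') by rewrite /= b0.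
rewrite bs'E all_cat /= => /and4P[r1_0 x0 y0 r2_0].
(* The affected pair goes to the end, where the two-coordinate hypothesis applies. *)
rewrite (Phi_perm _ ((r ++ r1 ++ r2) ++ [:: x; y])); last first.
  rewrite -!catA !perm_cat2l -[x :: y :: r2]/([:: x; y] ++ r2).
  by rewrite perm_catC.
apply: (le_trans (Phi_transfer _ _ _ _ _ y0 ya ax)).
  by rewrite !all_cat r0 r1_0.
rewrite (Phi_perm _ (rcons r a ++ (r1 ++ (x + y - a) :: r2))); last first.
  by apply/permP => Q; rewrite -cats1 !count_cat /=; ring.
rewrite -[X in (_ <= Phi X)%E]cat_rcons; apply: IHs => //.
- exact: path_sorted sa.
- by rewrite all_cat r1_0 /= r2_0 andbT; lra.
- by rewrite all_rcons r0 andbT; lra.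
Qed.

(** Read from the largest entry down, partial sums are the tail sums in [majorized], and the slack
    is their difference. *)
Lemma majorized_dominated (n : nat) (a b : 'I_n -> R) : majorized a b ->
  dominated 0 (rev (increasing_rearrangement a))
              (rev (increasing_rearrangement b)).
Proof.
move=> [sum_ab tail_ab].
set s := increasing_rearrangement a in tail_ab *.
set s' := increasing_rearrangement b in tail_ab *.
have size_s : size s = n by rewrite size_sort size_codom card_ord.
have size_s' : size s' = n by rewrite size_sort size_codom card_ord.
have sumE (c : 'I_n -> R) :
    \sum_(0 <= i < n) (increasing_rearrangement c)`_i = \sum_(i < n) c i.
  have sc : size (increasing_rearrangement c) = n.
    by rewrite size_sort size_codom card_ord.
  transitivity (\sum_(x <- increasing_rearrangement c) x).
    rewrite [RHS](big_nth 0).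
    exact: (congr1 (fun m => \sum_(0 <= i < m) _) (esym sc)).
  rewrite (perm_big (codom c)) /=; last by rewrite perm_sort.
  by rewrite codomE big_map big_enum.
(* [D k] is the slack after the n - k largest entries; [take k] keeps the k smallest ones. *)
pose D k := \sum_(k <= i < n) s'`_i - \sum_(k <= i < n) s`_i.
have D_ge0 k : (k < n)%N -> 0 <= D k.
  (* For k = 0 nonnegativity comes from the equality of the total sums, not from a tail
     inequality. *)
  case: k => [|k] kn; first by rewrite /D !sumE sum_ab subrr.
  by rewrite subr_ge0; exact: tail_ab.
have D_step k : (k < n)%N -> D k = D k.+1 + s'`_k - s`_k.
  move=> kn; rewrite /D big_ltn // [X in _ - X = _]big_ltn //; ring.
suff H k : (k <= n)%N -> dominated (D k) (rev (take k s)) (rev (take k s')).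
  have := H n (leqnn n); rewrite /D !big_geq // subrr.
  by rewrite -{1}size_s -size_s' !take_size.
elim: k => [_|k IHk kn]; first by rewrite !take0 /= /D !sumE sum_ab subrr.
rewrite !(take_nth 0) ?size_s ?size_s' // !rev_rcons /= -D_step //.
by split; [exact: D_ge0 | exact: IHk (ltnW kn)].
Qed.

End majorization.

(** * Iterated integrals over the plane *)

Section iterated_integral.
Local Open Scope ereal_scope.
Context {R : realType}.
Local Notation mu := (@lebesgue_measure R).
Implicit Types phi psi : R * R -> \bar R.

Lemma measurable_integral_snd phi :
  measurable_fun setT phi -> (forall z, 0 <= phi z) ->
  measurable_fun setT (fun x => \int[mu]_y phi (x, y)).
Proof.
move=> mphi phi0.
exact: (@measurable_fun_fubini_tonelli_F _ _ (measurableTypeR R)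
  (measurableTypeR R) R mu phi).
Qed.

Lemma ge0_le_integral2 phi psi :
  measurable_fun setT phi -> measurable_fun setT psi ->
  (forall z, 0 <= phi z) -> (forall z, phi z <= psi z) ->
  \int[mu]_x \int[mu]_y phi (x, y) <= \int[mu]_x \int[mu]_y psi (x, y).
Proof.
move=> mphi mpsi phi0 phipsi.
have psi0 z : 0 <= psi z by exact: le_trans (phipsi z).
apply: ge0_le_integral => //.
- by move=> x _; exact: integral_ge0.
- exact: measurable_integral_snd.
- exact: measurable_integral_snd.
- move=> x _; apply: ge0_le_integral => //.
  + exact/measurableT_comp.
  + exact/measurableT_comp.
Qed.

Lemma ge0_integral2D phi psi :
  measurable_fun setT phi -> measurable_fun setT psi ->
  (forall z, 0 <= phi z) -> (forall z, 0 <= psi z) ->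
  \int[mu]_x \int[mu]_y (phi (x, y) + psi (x, y)) =
  \int[mu]_x \int[mu]_y phi (x, y) + \int[mu]_x \int[mu]_y psi (x, y).
Proof.
move=> mphi mpsi phi0 psi0.
rewrite -ge0_integralD //; last 4 first.
- by move=> x _; exact: integral_ge0.
- exact: measurable_integral_snd.
- by move=> x _; exact: integral_ge0.
- exact: measurable_integral_snd.
by apply: eq_integral => x _; rewrite ge0_integralD //; exact/measurableT_comp.
Qed.

Lemma ge0_integral2_density (nu : {sigma_finite_measure set R -> \bar R})
    (f : R -> R) phi :
  measurable_fun setT f -> (forall y, (0 <= f y)%R) ->
  (forall A, measurable A -> nu A = \int[mu]_(y in A) (f y)%:E) ->
  measurable_fun setT phi -> (forall z, 0 <= phi z) ->
  \int[nu]_x \int[nu]_y phi (x, y) =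
  \int[mu]_x \int[mu]_y (phi (x, y) * (f x * f y)%:E).
Proof.
move=> mf f0 nuE mphi phi0.
have mEf : measurable_fun setT (EFin \o f) by exact/measurable_EFinP.
rewrite (ge0_integral_density mf f0 nuE); last 2 first.
- exact: (measurable_fun_fubini_tonelli_F phi).
- by move=> x; exact: integral_ge0.
apply: eq_integral => x _.
have mphix : measurable_fun setT (fun y => phi (x, y)).
  exact/measurableT_comp.
rewrite (ge0_integral_density mf f0 nuE) // -ge0_integralZr //.
- apply: eq_integral => y _; rewrite -muleA -EFinM; congr (_ * _%:E); ring.
- by apply: emeasurable_funM.
- by move=> y _; rewrite mule_ge0 ?lee_fin.
- by rewrite lee_fin.
Qed.

End iterated_integral.

(** * Rayleigh case: reflection of half planes *)

Section reflected_half_planes.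
Context {R : realType}.
Local Notation mu := (@lebesgue_measure R).

(** In polar coordinates the mirror has an angle phi <= pi/4, because k >= 1, and the image of z has
    an angle theta in (0, phi). So z has the angle 2 phi - theta in (0, pi/2), at least as close to
    pi/4, and the product of coordinates on a circle is largest there. *)
Lemma reflect_across_rayleigh (k : R) (z : R * R) :
  1 <= k -> z.1 < k * z.2 ->
  0 < (reflect_across k z).1 -> 0 < (reflect_across k z).2 ->
  [/\ 0 < z.1, 0 < z.2,
      (reflect_across k z).1 * (reflect_across k z).2 <= z.1 * z.2 &
      (reflect_across k z).1 ^+ 2 + (reflect_across k z).2 ^+ 2 =
      z.1 ^+ 2 + z.2 ^+ 2].
Proof.
case: z => z1 z2 /= k1 zk; set m := 2 * k / (1 + k ^+ 2).
have mE : m * (1 + k ^+ 2) = 2 * k by rewrite /m; field; nra.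
have km1 : 1 <= k * m.
  have -> : k * m = 2 * k ^+ 2 / (1 + k ^+ 2) by rewrite /m; field; nra.
  by rewrite ler_pdivlMr; nra.
have m0 : 0 <= m by nra.
(* All is expressed through [w], proportional to the distance from the mirror, and [s], the second
   coordinate of the image. Both are positive, and the coefficients m and k m - 1 are
   nonnegative. *)
have [w wE] : exists w, w = k * z2 - z1 by exists (k * z2 - z1).
have -> : z1 - k * z2 = - w by rewrite wE; ring.
have [s sE] : exists s, s = z2 + m * - w by exists (z2 + m * - w).
have w0 : 0 < w by rewrite wE; lra.
rewrite -sE opprK => z1'0 s0.
have z2E : z2 = s + m * w by rewrite sE; ring.
have z1E : z1 = k * s + (k * m - 1) * w by rewrite sE wE; ring.
have mw : 0 <= m * w by nra.
have kmw : 0 <= (k * m - 1) * w by nra.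
split.
- by rewrite z1E; nra.
- by rewrite z2E; lra.
- rewrite z1E z2E -subr_ge0.
  have -> : (k * s + (k * m - 1) * w) * (s + m * w) - (w + k * s) * s =
     2 * (s * ((k * m - 1) * w)) + ((k * m - 1) * w) * (m * w) by ring.
  by rewrite addr_ge0 // mulr_ge0 //; rewrite mulr_ge0 // ltW.
- rewrite z1E z2E; apply/eqP; rewrite -subr_eq0; apply/eqP.
  transitivity ((s + m * w + s) * w * (2 * k - m * (1 + k ^+ 2))).
    by ring.
  by rewrite mE subrr mulr0.
Qed.

(* The reflection exchanging the vectors a and b exchanges the two half planes,
   and it carries their difference to points where F is smaller. *)
Lemma half_plane_mass_le (F : R * R -> R) (a1 a2 b1 b2 t : R) :
  measurable_fun setT F -> (forall z, 0 <= F z) ->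
  (forall k z, 1 <= k -> z.1 < k * z.2 -> F (reflect_across k z) <= F z) ->
  0 < b2 -> b2 <= a2 -> a2 <= a1 -> a1 <= b1 ->
  a1 ^+ 2 + a2 ^+ 2 = b1 ^+ 2 + b2 ^+ 2 ->
  (\int[mu]_x \int[mu]_y
     (if t < b1 * x + b2 * y then F (x, y) else 0)%R%:E <=
   \int[mu]_x \int[mu]_y
     (if t < a1 * x + a2 * y then F (x, y) else 0)%R%:E)%E.
Proof.
move=> mF F0 FP b2_gt0 ba2 a21 ab1 norm_ab.
move: ab1; rewrite le_eqVlt => /predU1P[ab1|ab1].
  suff -> : a2 = b2 by rewrite ab1.
  apply/eqP; rewrite -(@eqrXn2 _ 2%N) //; [|lra|lra].
  by apply/eqP; move: norm_ab; rewrite ab1; lra.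
have a2b2 : 0 < a2 + b2 by lra.
(* As a and b have equal norms, the mirror exchanging them is the line through a + b. *)
pose k := (b1 + a1) / (a2 + b2).
have kE : k * (a2 + b2) = b1 + a1 by rewrite /k divfK //; lra.
have k1 : 1 <= k by rewrite ler_pdivlMr //; lra.
have k2 : 0 < 1 + k ^+ 2 by nra.
pose e := b1 - a1.
have e0 : 0 < e by rewrite /e; lra.
have a1E : a1 = b1 - e by rewrite /e; ring.
(* Equal norms make b - a orthogonal to the mirror, so b - a = e (1, -k). *)
have a2E : a2 = b2 + k * e.
  apply: (@mulIf _ (a2 + b2)); first by lra.
  rewrite mulrDl -mulrA [e * _]mulrC mulrA kE /e; nra.
have eE : e = 2 * (b1 - k * b2) / (1 + k ^+ 2).
  apply: (@mulIf _ (1 + k ^+ 2)); first by lra.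
  rewrite divfK; last by lra.
  by move: kE; rewrite a2E a1E; nra.
pose La z := a1 * z.1 + a2 * z.2.
pose Lb z := b1 * z.1 + b2 * z.2.
have La_refl z : La (reflect_across k z) = Lb z.
  by rewrite /La /Lb /= a1E a2E eE; field; lra.
have Lb_refl z : Lb (reflect_across k z) = La z.
  by rewrite /La /Lb /= a1E a2E eE; field; lra.
have mLa : measurable_fun setT La.
  by apply: measurable_funD; apply: measurable_funM.
have mLb : measurable_fun setT Lb.
  by apply: measurable_funD; apply: measurable_funM.
have mif (B : R * R -> bool) : measurable_fun setT B ->
    measurable_fun setT (fun z => (if B z then F z else 0)%:E).
  by move=> mB; apply/measurable_EFinP; apply: measurable_fun_ifT.
have mta : measurable_fun setT (fun z => t < La z).
  by apply: measurable_fun_ltr.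
have mtb : measurable_fun setT (fun z => t < Lb z).
  by apply: measurable_fun_ltr.
(* [both] and [only_b] split the old half plane; the reflection carries the second piece into the
   new half plane, outside the old one. *)
pose both z := (if (t < La z) && (t < Lb z) then F z else 0)%:E.
pose only_b z := (if ~~ (t < La z) && (t < Lb z) then F z else 0)%:E.
have mboth : measurable_fun setT both.
  by apply: (mif (fun z => _ && _)); exact: measurable_and mta mtb.
have monly : measurable_fun setT only_b.
  apply: (mif (fun z => ~~ _ && _)).
  exact: measurable_and (measurable_neg mta) mtb.
have if0 (B : bool) z : (0 <= (if B then F z else 0)%:E)%E.
  by rewrite lee_fin; case: B.
have mrefl : measurable_fun setT (reflect_across k).
  have mu1 : measurable_fun setT (fun z : R * R => z.1 - k * z.2).
    by apply: measurable_funB => //; apply: measurable_funM.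
  have mv : measurable_fun setT (fun z : R * R => (reflect_across k z).2).
    by apply: measurable_funD => //; apply: measurable_funM.
  apply: measurable_fun_pair => //; apply: measurable_funD.
    exact: measurableT_comp.
  exact: measurable_funM.
have monly_refl : measurable_fun setT (only_b \o reflect_across k).
  exact: measurableT_comp.
have both0 z : (0 <= both z)%E by exact: if0.
have only0 z : (0 <= only_b z)%E by exact: if0.
apply: (@le_trans _ _ (\int[mu]_x \int[mu]_y (both (x, y) + only_b (x, y)))%E).
  apply: (@ge0_le_integral2 _ (fun z => (if t < Lb z then F z else 0)%:E)
    (fun z => both z + only_b z)%E) => //.
  - exact: mif.
  - exact: emeasurable_funD.
  - move=> z; rewrite /both /only_b.
    by case: (t < La z); case: (t < Lb z); rewrite /= -EFinD ?addr0 ?add0r.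
rewrite ge0_integral2D //.
rewrite -(ge0_integral2_reflect k monly only0).
rewrite -(@ge0_integral2D _ both (only_b \o reflect_across k)) //;
  last by move=> z; exact: only0.
apply: (@ge0_le_integral2 _ (fun z => both z + (only_b \o reflect_across k) z)%E
  (fun z => (if t < La z then F z else 0)%:E)) => //.
- exact: emeasurable_funD.
- exact: mif.
- by move=> z; rewrite adde_ge0 //; exact: only0.
- move=> z; rewrite /both /only_b [(_ \o _) z]/= La_refl Lb_refl.
  case: ltP => ta; case: ltP => tb; rewrite /= -EFinD ?addr0 ?add0r lee_fin //.
  (* Here Lb z <= t < La z, and La z - Lb z = e (k z.2 - z.1), so z lies on the required side of the
     mirror. *)
  apply: FP => //; have := lt_le_trans ta (le_refl (La z)).
  move: tb; rewrite /La /Lb a1E a2E; nra.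
Qed.

End reflected_half_planes.

Section rayleigh.
Context {R : realType}.
Local Notation mu := (@lebesgue_measure R).

Lemma weighted_tail2_density (nu : {sigma_finite_measure set R -> \bar R})
    (f : R -> R) (c1 c2 t : R) :
  measurable_fun setT f -> (forall y, 0 <= f y) ->
  (forall A, measurable A -> nu A = (\int[mu]_(y in A) (f y)%:E)%E) ->
  weighted_tail nu [:: c1; c2] t =
  (\int[mu]_x \int[mu]_y
     (if t < c1 * x + c2 * y then f x * f y else 0)%R%:E)%E.
Proof.
move=> mf f0 nuE.
pose phi (z : R * R) : \bar R := (\1_`]-oo, 0[ (t - c1 * z.1 - c2 * z.2))%:E.
have mphi : measurable_fun setT phi.
  apply/measurable_EFinP; apply: measurableT_comp => //.
  apply: measurable_funB; last by apply: measurable_funM.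
  by apply: measurable_funB => //; apply: measurable_funM.
have phi0 z : (0 <= phi z)%E by rewrite lee_fin.
rewrite /= (ge0_integral2_density mf f0 nuE mphi phi0).
apply: eq_integral => x _; apply: eq_integral => y _.
rewrite /phi indicE mem_setE in_itv /= -addrA -opprD subr_lt0 -EFinM.
by case: ifP => _; rewrite ?mul1r ?mul0r.
Qed.

(** On the positive quadrant the joint density depends only on y1 y2 and y1^2 + y2^2, and it
    increases with the former since v >= 1. If the image leaves the quadrant, the left side is 0. *)
Lemma rayleigh_density_reflect (c v k : R) (z : R * R) :
  0 <= c -> 1 <= v -> 1 <= k -> z.1 < k * z.2 ->
  c * rayleigh_kernel v (reflect_across k z).1 *
    (c * rayleigh_kernel v (reflect_across k z).2) <=
  c * rayleigh_kernel v z.1 * (c * rayleigh_kernel v z.2).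
Proof.
move=> c0 v1 k1 zk; rewrite mulrACA [leRHS]mulrACA ler_wpM2l ?mulr_ge0 //.
have ker_ge0 y : 0 <= rayleigh_kernel v y.
  rewrite /rayleigh_kernel; case: ifP => // _.
  by rewrite mulr_ge0 ?powR_ge0 ?expR_ge0.
set z' := reflect_across k z.
have [z'1|z'1] := ltP 0 z'.1; last first.
  by rewrite {1}/rayleigh_kernel ltNge z'1 /= mul0r mulr_ge0.
have [z'2|z'2] := ltP 0 z'.2; last first.
  by rewrite {2}/rayleigh_kernel ltNge z'2 /= mulr0 mulr_ge0.
have [z1 z2 prod_le norm_eq] := reflect_across_rayleigh k1 zk z'1 z'2.
have ker2 y1 y2 : 0 < y1 -> 0 < y2 ->
    rayleigh_kernel v y1 * rayleigh_kernel v y2 =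
    (y1 * y2) `^ (v - 1) * expR (- ((y1 ^+ 2 + y2 ^+ 2) / 2)).
  move=> y10 y20; rewrite /rayleigh_kernel y10 y20 mulrACA -powRM ?ltW //.
  by rewrite -expRD; congr (_ * expR _); field.
rewrite !ker2 // norm_eq ler_wpM2r ?expR_ge0 //.
by rewrite ge0_ler_powR ?nnegrE ?subr_ge0 ?mulr_ge0
  ?(ltW z'1) ?(ltW z'2) ?(ltW z1) ?(ltW z2).
Qed.

Lemma rayleigh_transfer (nu : {sigma_finite_measure set R -> \bar R})
    (c v x a y t : R) :
  1 <= v ->
  measurable_fun setT (fun u => c * rayleigh_kernel v u) ->
  (forall u, 0 <= c * rayleigh_kernel v u) ->
  (forall A, measurable A ->
     nu A = (\int[mu]_(u in A) (c * rayleigh_kernel v u)%:E)%E) ->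
  0 < y -> y <= a -> a <= x ->
  (weighted_tail nu [:: x `^ 2^-1; y `^ 2^-1]%R t <=
   weighted_tail nu [:: a `^ 2^-1; (x + y - a) `^ 2^-1]%R t)%E.
Proof.
move=> v1 mf f0 nuE y0 ya ax.
(* Swapping the two summands allows [a] to be the larger of the two new values. *)
wlog ma : a ya ax / x + y - a <= a => [hw|].
  case: (lerP (x + y - a) a) => [ma|/ltW am]; first exact: (hw a ya ax ma).
  rewrite [leRHS]weighted_tail_swap.
  have aE : x + y - (x + y - a) = a by ring.
  have := hw (x + y - a); rewrite aE; apply; lra.
rewrite !(weighted_tail2_density _ _ _ mf f0 nuE).
have c0 : 0 <= c.
  (* The kernel is positive at 1, so the sign of the density there is that of [c]. *)
  have := f0 1; rewrite /rayleigh_kernel ltr01 powR1 mul1r.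
  by rewrite pmulr_lge0 ?expR_gt0.
have sq u : 0 < u -> (u `^ 2^-1) ^+ 2 = u.
  by move=> u0; rewrite powR12_sqrt ?sqr_sqrtr // ltW.
have mono u w : 0 < u -> u <= w -> u `^ 2^-1 <= w `^ 2^-1.
  by move=> u0 uw; rewrite ge0_ler_powR ?nnegrE ?invr_ge0 //; lra.
apply: (@half_plane_mass_le _ (fun z => c * rayleigh_kernel v z.1 *
    (c * rayleigh_kernel v z.2))).
- by apply: measurable_funM; apply: (measurableT_comp mf).
- by move=> z; rewrite mulr_ge0.
- by move=> k z k1 zk; exact: rayleigh_density_reflect.
- exact: powR_gt0.
- by apply: mono; lra.
- by apply: mono; lra.
- by apply: mono; lra.
- by rewrite !sq; lra.
Qed.

End rayleigh.

(** * Weibull case: reduction to exponential variables *)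

Section weibull_tail.
Context {R : realType}.
Local Notation mu := (@lebesgue_measure R).

Lemma weibull_tail (p a : R) : 1 <= p -> 0 < a ->
  (\int[mu]_(y in `[a, +oo[) (weibull_pdf p y)%:E = (expR (- (a `^ p)))%:E)%E.
Proof.
move=> p1 a0; pose f y : R := p * y `^ (p - 1) * expR (- (y `^ p)).
pose F y : R := - expR (- (y `^ p)).
have dF (y : R) : 0 < y -> is_derive y 1 F (f y).
  move=> y0; have dpow := is_derive1_powR p y0.
  have dexp := @is_derive1_comp _ expR (fun y : R => - (y `^ p)) y _ _
    (is_derive_expR _) (is_deriveN dpow).
  apply: is_derive_eq (is_deriveN dexp) _.
  rewrite /f; ring.
have cf (y : R) : 0 < y -> {for y, continuous f}.
  move=> y0; have cpow b : {for y, continuous (fun y : R => y `^ b)}.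
    apply: differentiable_continuous; apply/derivable1_diffP.
    exact: (@ex_derive _ _ _ _ _ _ _ (is_derive1_powR b y0)).
  apply: continuousM; first by apply: continuousM => //; exact: cst_continuous.
  apply: (@continuous_comp _ _ _ (fun y : R => - (y `^ p)) expR).
    by apply: continuousN.
  exact: continuous_expR.
transitivity (\int[mu]_(y in `[a, +oo[) (f y)%:E)%E.
  apply: eq_integral => y; rewrite inE /= in_itv /= andbT => ay.
  by rewrite /weibull_pdf (lt_le_trans a0 ay).
rewrite (@ge0_continuous_FTC2y _ f F a 0).
- by rewrite /F EFinN oppeK add0e.
- by move=> y ay; rewrite /f !mulr_ge0 ?powR_ge0 ?expR_ge0 //; lra.
- apply: continuous_in_subspaceT => y; rewrite inE /= in_itv /= andbT => ay.
  by apply: cf; exact: lt_le_trans ay.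
- rewrite -oppr0; apply: cvgN.
  (* For y >= 1 one has y <= y^p, so exp(-y) dominates exp(-y^p). *)
  apply: (@squeeze_cvgr _ _ _ _ (fun=> 0) (fun y : R => expR (- y))).
  + near=> y; rewrite expR_ge0 /= ler_expR lerN2.
    have y1 : 1 <= y by near: y; exact: nbhs_pinfty_ge.
    by rewrite -[leLHS]powRr1 ?ler_powR //; lra.
  + exact: cvg_cst.
  + exact: cvgr_expR.
- move=> y ay; apply: (@ex_derive _ _ _ _ _ _ _ (dF y _)).
  exact: lt_trans ay.
- apply: cvg_at_right_filter.
  apply: differentiable_continuous; apply/derivable1_diffP.
  exact: (@ex_derive _ _ _ _ _ _ _ (dF a a0)).
- move=> y; rewrite in_itv /= andbT => ay.
  rewrite derive1E; apply: derive_val; apply: dF; exact: lt_trans ay.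
Unshelve. all: by end_near. Qed.

End weibull_tail.

Section closed_rays.
Context {R : realType}.

(** Closed rays are stable under intersection and generate the Borel sets, and the rays from -n
    exhaust the line with finite mass. *)
Lemma finite_measure_eq_rays (m1 m2 : {measure set R -> \bar R}) :
  (m1 setT < +oo)%E ->
  (forall a : R, m1 `[a, +oo[%classic = m2 `[a, +oo[%classic) ->
  forall A, measurable A -> m1 A = m2 A.
Proof.
move=> m1oo m12 A mA.
pose g (n : nat) : set R := `[(- n%:R)%R, +oo[%classic.
apply: (@g_sigma_algebra_measure_unique _ _ _ (@RGenCInfty.G R) _ g).
- by move=> _ [x ->]; exact: measurable_itv.
- by move=> n; exists (- n%:R : R).
- apply/seteqP; split=> // x _; exists (Num.truncn `|x|).+1 => //=.
  rewrite /g /= in_itv /= andbT lerNl ltW //.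
  by apply: le_lt_trans (truncnS_gt _); rewrite -normrN ler_norm.
- move=> _ _ [x ->] [y ->]; exists (Num.max x y).
  by apply/seteqP; split=> z /=; rewrite !in_itv /= !andbT ge_max => /andP.
- by move=> _ [x ->].
- move=> n; apply: le_lt_trans m1oo.
  by rewrite le_measure ?inE //; exact: measurable_itv.
- suff : (@RGenCInfty.G R).-sigma.-measurable A by [].
  by rewrite -RGenCInfty.measurableE; exact: mA.
Qed.

End closed_rays.

Section weibull_law.
Context {R : realType}.
Local Notation mu := (@lebesgue_measure R).

(* Truncated at 0 because z `^ r = 1 for z < 0. *)
Definition pos_root (p z : R) : R := Num.max z 0 `^ p^-1.

Lemma measurable_pos_root p : measurable_fun setT (pos_root p).
Proof.
apply: (measurableT_comp (measurable_powR p^-1)).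
by apply: measurable_maxr => //; exact: measurable_cst.
Qed.

(* The p-th root of a standard exponential variable is Weibull. *)
Lemma ge0_integral_weibull (p : R) (nu : {measure set R -> \bar R})
    (phi : R -> \bar R) : 1 < p -> nu setT = 1%E ->
  (forall A, measurable A ->
     nu A = (\int[mu]_(y in A) (weibull_pdf p y)%:E)%E) ->
  measurable_fun setT phi -> (forall y, (0 <= phi y)%E) ->
  (\int[nu]_y phi y =
   \int[mu]_z (phi (pos_root p z) * (exponential_pdf 1 z)%:E))%E.
Proof.
move=> p1 nuT nuE mphi phi0.
have p0 : 0 < p by lra.
have one0 : 0 < 1 :> R by [].
pose eta0 : probability (measurableTypeR R) R :=
  exponential_distribution_exponential_prob__canonical__probability_measure_Probability one0.
have mid : measurable_fun setT (fun z : measurableTypeR R => z : R) by [].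
have [eta etaE] : exists eta : {measure set R -> \bar R}, forall A,
    measurable A -> eta A = (\int[mu]_(z in A) (exponential_pdf 1 z)%:E)%E.
  by unshelve eexists (pushforward eta0 (fun z : measurableTypeR R => z : R)).
have etaT : eta setT = 1%E by rewrite etaE // integral_exponential_pdf.
have eta_tail a : 0 < a -> eta `[a, +oo[%classic = (expR (- a))%:E.
  (* The exponential law is Weibull with parameter 1. *)
  move=> a0; rewrite etaE // -{2}(powRr1 (ltW a0)) -weibull_tail //.
  apply: eq_integral => z; rewrite inE /= in_itv /= andbT => az.
  have z0 := lt_le_trans a0 az.
  rewrite exponential_pdfE ?ltW // /weibull_pdf z0 subrr powRr0.
  by rewrite powRr1 ?ltW // mulr1 !mul1r mulN1r.
have mroot : measurable_fun setT (pos_root p).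
  exact: measurable_pos_root.
have nu_eta A : measurable A -> nu A = pushforward eta (pos_root p) A.
  apply: finite_measure_eq_rays => [|a]; first by rewrite nuT ltry.
  have [a0|a0] := ltP 0 a.
    rewrite nuE // weibull_tail ?ltW // /pushforward -eta_tail ?powR_gt0 //.
    congr (eta _); apply/seteqP.
    split => z /=; rewrite !in_itv /= !andbT /pos_root => az.
      have z0 : 0 < z by rewrite (lt_le_trans _ az) // powR_gt0.
      have -> : a = (a `^ p) `^ p^-1.
        by rewrite -powRrM divff ?gt_eqF // powRr1 // ltW.
      rewrite max_l ?(ltW z0) //.
      by rewrite ge0_ler_powR ?nnegrE ?invr_ge0 ?powR_ge0 ?(ltW z0) ?(ltW p0).
    have [z0|z0] := ltP 0 z; last first.
      by move: az; rewrite max_r // powR0 ?invr_eq0 ?gt_eqF // leNgt a0.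
    move: az; rewrite max_l ?(ltW z0) // => az.
    have -> : z = (z `^ p^-1) `^ p.
      by rewrite -powRrM mulVf ?gt_eqF // powRr1 // ltW.
    by rewrite ge0_ler_powR ?nnegrE ?powR_ge0 ?(ltW p0) ?(ltW a0).
  (* For a <= 0 both rays have full mass: [pos_root] is nonnegative, and the Weibull density
     vanishes below a. *)
  transitivity (1%E : \bar R); last first.
    rewrite /= /pushforward (_ : _ @^-1` _ = setT) ?etaT //.
    apply/seteqP; split => // z _ /=; rewrite in_itv /= andbT.
    by rewrite (le_trans a0) // powR_ge0.
  rewrite -nuT [RHS](_ : nu setT =
    (nu `]-oo, a[%classic + nu `[a, +oo[%classic)%E); last first.
    rewrite -measureU //.
    - congr (nu _); apply/seteqP; split => // z _ /=.
      by rewrite !in_itv /= andbT; case: ltP => _; [left|right].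
    - apply/seteqP; split => // z /=; rewrite !in_itv /= andbT => -[za az].
      by move: (lt_le_trans za az); rewrite ltxx.
  rewrite (nuE `]-oo, a[%classic) // integral0_eq ?add0e // => z /=.
  rewrite in_itv /= => za.
  by rewrite /weibull_pdf ltNge (le_trans (ltW za)).
transitivity (\int[pushforward eta (pos_root p)]_y phi y)%E.
  by apply: eq_measure_integral => A mA _; exact: nu_eta.
rewrite ge0_integral_pushforward //.
rewrite (ge0_integral_density (measurable_exponential_pdf _) _ etaE) //.
- by move=> z; exact: exponential_pdf_ge0.
- exact: measurableT_comp.
- by move=> z; exact: phi0.
Qed.

End weibull_law.

(** * Weibull case: lengths of intervals and concavity *)

Section segment_length.
Context {R : realType}.
Local Notation mu := (@lebesgue_measure R).

(* Some translate of the open interval spanned by A lies in B: move the first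
   point of the hypothesis upwards and the second one downwards through A. *)
Lemma interval_measure_le (A B : set R) (l s lo hi : R) :
  0 <= l <= 1 -> is_interval A -> (forall z, A z -> lo <= z <= hi) ->
  measurable B -> (forall z w, A z -> A w -> B (l * z + (1 - l) * (s - w))) ->
  (mu A <= mu B)%E.
Proof.
move=> /andP[l0 l1] itvA Alohi mB AB.
have [->|A0] := eqVneq A set0; first by rewrite measure0 measure_ge0.
have {}A0 : A !=set0 by exact/set0P.
have lbA : has_lbound A by exists lo => z /Alohi /andP[].
have ubA : has_ubound A by exists hi => z /Alohi /andP[].
have infsup : inf A <= sup A.
  by have [z Az] := A0; rewrite (le_trans (ge_inf lbA Az)) // ub_le_sup.
have insideA z : inf A < z -> z < sup A -> A z.
  move=> /(inf_lt A0) [z1 Az1 z1z] /(sup_gt A0) [z2 Az2 zz2].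
  by apply: (itvA z1 z2) => //; rewrite (ltW z1z) (ltW zz2).
(* If w = inf A + sup A - z is the mirror image of z in the midpoint of [A], then l z + (1 - l) (s -
   w) = z + tau. *)
pose tau := (1 - l) * (s - inf A - sup A).
have le1 : (mu A <= mu `[inf A, sup A])%E.
  apply: le_measure; rewrite ?inE //=; first exact: is_interval_measurable.
  by move=> z Az; rewrite /= in_itv /= ge_inf // ub_le_sup.
have le2 : (mu `](inf A + tau)%R, (sup A + tau)%R[ <= mu B)%E.
  apply: le_measure; rewrite ?inE //= => z; rewrite /= in_itv /= => /andP[z1 z2].
  have -> : z = l * (z - tau) + (1 - l) * (s - (inf A + sup A - (z - tau))).
    by rewrite /tau; ring.
  by apply: AB; apply: insideA; lra.
apply: (le_trans le1); apply: le_trans le2.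
rewrite !lebesgue_measure_itv /= !lte_fin ltrD2r.
case: ifP => // _; rewrite -!EFinD lee_fin; lra.
Qed.

(** Two-term Hoelder inequality, each weight w being split as w^(1/p) w^(1/q). *)
Lemma powR_mul_concave (p q l u1 u2 z1 z2 : R) : 1 < p -> p^-1 + q^-1 = 1 ->
  0 <= l <= 1 -> 0 <= u1 -> 0 <= u2 -> 0 <= z1 -> 0 <= z2 ->
  l * (u1 `^ q^-1 * z1 `^ p^-1) + (1 - l) * (u2 `^ q^-1 * z2 `^ p^-1) <=
  (l * u1 + (1 - l) * u2) `^ q^-1 * (l * z1 + (1 - l) * z2) `^ p^-1.
Proof.
move=> p1 pq /andP[l0 l1] u10 u20 z10 z20.
have p0 : 0 < p by lra.
have q0 : 0 < q.
  rewrite -invr_gt0; have : p^-1 < 1 by rewrite invf_lt1.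
  lra.
have m0 : 0 <= 1 - l by lra.
have rootK r v : 0 < r -> 0 <= v -> (v `^ r^-1) `^ r = v.
  by move=> r0 v0; rewrite -powRrM mulVf ?gt_eqF // powRr1.
have split_weight w u z : 0 <= w -> 0 <= u -> 0 <= z ->
    (w * z) `^ p^-1 * (w * u) `^ q^-1 = w * (u `^ q^-1 * z `^ p^-1).
  move=> w0 u0 z0; rewrite !powRM // mulrACA -powRD; last first.
    by rewrite pq oner_eq0.
  by rewrite pq powRr1 //; ring.
rewrite -!split_weight // [leRHS]mulrC.
have := @hoelder2 R ((l * z1) `^ p^-1) (((1 - l) * z2) `^ p^-1)
  ((l * u1) `^ q^-1) (((1 - l) * u2) `^ q^-1) p q.
rewrite !rootK ?mulr_ge0 //; apply => //; exact: powR_ge0.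
Qed.

End segment_length.

(** * Weibull case: transfer between two summands *)

Section weibull_transfer.
Context {R : realType}.
Local Notation mu := (@lebesgue_measure R).
Variables p q : R.
Hypotheses (p1 : 1 < p) (pq : p^-1 + q^-1 = 1).

(* z and s - z are the p-th powers of the two Weibull variables. *)
Let segment (u1 u2 t s : R) : set R :=
  [set z | 0 <= z <= s /\
           t < u1 `^ q^-1 * z `^ p^-1 + u2 `^ q^-1 * (s - z) `^ p^-1].

(** Adds the concavity inequalities for the two summands, at z, w and at s - z, s - w. *)
Let segment_combination l u1 u2 u1' u2' t s z w : 0 <= l <= 1 ->
  0 <= u1 -> 0 <= u2 -> 0 <= u1' -> 0 <= u2' ->
  segment u1 u2 t s z -> segment u1' u2' t s w ->
  segment (l * u1 + (1 - l) * u1') (l * u2 + (1 - l) * u2') t s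
    (l * z + (1 - l) * w).
Proof.
move=> l01 u10 u20 u1'0 u2'0 [/andP[z0 zs] tz] [/andP[w0 ws] tw].
have /andP[l0 l1] := l01; split; first by apply/andP; split; nra.
have -> : s - (l * z + (1 - l) * w) = l * (s - z) + (1 - l) * (s - w) by ring.
have h1 := powR_mul_concave p1 pq l01 u10 u1'0 z0 w0.
have sz : 0 <= s - z by lra.
have sw : 0 <= s - w by lra.
have h2 := powR_mul_concave p1 pq l01 u20 u2'0 sz sw.
apply: (lt_le_trans _ (lerD h1 h2)).
have [l0'|l0'] := eqVneq l 0; first by rewrite l0'; lra.
nra.
Qed.

Let segment_interval u1 u2 t s :
  0 <= u1 -> 0 <= u2 -> is_interval (segment u1 u2 t s).
Proof.
move=> u10 u20 z w Az Aw x /andP[zx xw].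
have [zw|wz] := ltP z w; last by have -> : x = z by lra.
pose l := (w - x) / (w - z).
have wz0 : 0 < w - z by lra.
have l01 : 0 <= l <= 1.
  by rewrite /l divr_ge0 ?ler_pdivrMr //=; lra.
have -> : x = l * z + (1 - l) * w by rewrite /l; field; lra.
have := segment_combination l01 u10 u20 u10 u20 Az Aw.
by rewrite -!mulrDl addrC subrK !mul1r.
Qed.

Let segment_reflect u1 u2 t s z :
  segment u1 u2 t s z -> segment u2 u1 t s (s - z).
Proof.
move=> [/andP[z0 zs] tz]; split; first by apply/andP; split; lra.
by rewrite subKr addrC.
Qed.

Let segment_measure_le x a y t s : 0 < y -> y <= a -> a <= x ->
  (mu (segment x y t s) <= mu (segment a (x + y - a) t s))%E.
Proof.
move=> y0 ya ax.
have [xy|xy] := eqVneq x y.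
  have -> : a = y by lra.
  by rewrite xy addrK.
have xy0 : 0 < x - y by rewrite subr_gt0 lt_neqAle eq_sym xy (le_trans ya).
(* With this [l], (a, x + y - a) = l (x, y) + (1 - l) (y, x). *)
pose l := (a - y) / (x - y).
have l01 : 0 <= l <= 1.
  by rewrite /l divr_ge0 ?ler_pdivrMr //=; lra.
have aE : a = l * x + (1 - l) * y by rewrite /l; field; lra.
have bE : x + y - a = l * y + (1 - l) * x by rewrite /l; field; lra.
apply: (@interval_measure_le _ _ _ l s 0 s) => //.
- by apply: segment_interval; lra.
- by move=> z [].
- by apply: is_interval_measurable; apply: segment_interval; lra.
- move=> z w Az /segment_reflect Aw; rewrite bE {1}aE.
  by apply: segment_combination => //; lra.
Qed.

(** For exponential variables z and s - z the joint density exp(-z) exp(-(s - z)) = exp(-s) is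
    constant in z, so the inner integral is a multiple of a length. [Psi] comes with its
    measurability so that two such integrals can be compared for each s. *)
Let weighted_tail_segment (nu : {sigma_finite_measure set R -> \bar R})
    u1 u2 t :
  nu setT = 1%E ->
  (forall A, measurable A ->
     nu A = (\int[mu]_(y in A) (weibull_pdf p y)%:E)%E) ->
  0 <= u1 -> 0 <= u2 ->
  exists Psi : R * R -> \bar R,
  [/\ measurable_fun setT Psi, forall z, (0 <= Psi z)%E,
  weighted_tail nu [:: u1 `^ q^-1; u2 `^ q^-1]%R t =
    (\int[mu]_s \int[mu]_z Psi (s, z))%E &
  forall s,
    (\int[mu]_z Psi (s, z) = (expR (- s))%:E * mu (segment u1 u2 t s))%E].
Proof.
move=> nuT nuE u10 u20.
set c1 := u1 `^ q^-1; set c2 := u2 `^ q^-1.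
pose e : R -> R := exponential_pdf 1.
have e0 z : 0 <= e z by exact: exponential_pdf_ge0.
have me : measurable_fun setT e by exact: measurable_exponential_pdf.
have mEe : measurable_fun setT (EFin \o e) by exact/measurable_EFinP.
pose phi (z : R * R) : \bar R := (\1_`]-oo, 0[ (t - c1 * z.1 - c2 * z.2))%:E.
have mphi : measurable_fun setT phi.
  apply/measurable_EFinP; apply: measurableT_comp => //.
  apply: measurable_funB; last by apply: measurable_funM.
  by apply: measurable_funB => //; apply: measurable_funM.
have phi0 z : (0 <= phi z)%E by rewrite lee_fin.
have mroot := measurable_pos_root p.
pose Theta (z : R * R) : \bar R :=
  (phi (pos_root p z.1, pos_root p z.2) * (e z.1 * e z.2)%:E)%E.
have Theta0 z : (0 <= Theta z)%E by rewrite mule_ge0 // lee_fin mulr_ge0.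
have mTheta : measurable_fun setT Theta.
  apply: emeasurable_funM.
    apply: measurableT_comp => //.
    by apply: measurable_fun_pair; exact: measurableT_comp.
  by apply/measurable_EFinP; apply: measurable_funM; exact: measurableT_comp.
have mshear : measurable_fun setT (fun z : R * R => (z.1, z.2 - z.1)).
  by apply: measurable_fun_pair => //; exact: measurable_funB.
have mswap : measurable_fun setT (fun z : R * R => (z.2, z.1 - z.2)).
  by apply: measurable_fun_pair => //; exact: measurable_funB.
exists (fun z => Theta (z.2, z.1 - z.2)); split=> //.
- exact: measurableT_comp.
- transitivity (\int[mu]_x \int[mu]_y Theta (x, y))%E.
    rewrite /= (ge0_integral_weibull p1 nuT nuE); last 2 first.
    + exact: (measurable_fun_fubini_tonelli_F phi).
    + by move=> x; exact: integral_ge0.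
    apply: eq_integral => x _.
    rewrite (ge0_integral_weibull p1 nuT nuE
      (phi := fun y => phi (pos_root p x, y))) //; last first.
      exact: measurableT_comp.
    rewrite -ge0_integralZr //.
    + by apply: eq_integral => y _; rewrite -muleA -EFinM [e y * e x]mulrC.
    + apply: emeasurable_funM => //.
      by apply: measurableT_comp => //; apply: measurable_fun_pair => //.
    + by move=> y _; rewrite mule_ge0 // lee_fin.
    + by rewrite lee_fin.
  transitivity (\int[mu]_x \int[mu]_s
      (Theta \o (fun z : R * R => (z.1, z.2 - z.1))%R) (x, s))%E.
    (* For fixed x, a translation replaces the second variable by s - x, where s is the sum. *)
    apply: eq_integral => x _.
    rewrite -(ge0_integral_translate (- x) (f := fun y => Theta (x, y))) //.
    exact: measurableT_comp.
  apply: (@lebesgue_tonelli _ (Theta \o (fun z : R * R => (z.1, z.2 - z.1)))).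
    exact: measurableT_comp.
  by move=> z; exact: Theta0.
- move=> s; rewrite -(setIT (segment u1 u2 t s)) -integral_indic //; last first.
    by apply: is_interval_measurable; exact: segment_interval.
  rewrite -ge0_integralZl_EFin ?expR_ge0 //; last first.
    apply/measurable_EFinP; apply: measurable_indic.
    by apply: is_interval_measurable; exact: segment_interval.
  apply: eq_integral => z _; rewrite /Theta /phi /= -!EFinM; congr EFin.
  have eE y : e y = if 0 <= y then expR (- y) else 0.
    rewrite /e; case: leP => y0; last by rewrite lt0_exponential_pdf.
    by rewrite exponential_pdfE // mul1r mulN1r.
  rewrite !eE !indicE mem_setE in_itv /= -addrA -opprD subr_lt0.
  have [z0|z0] := leP 0 z; last first.
    by rewrite mul0r mulr0 memNset ?mulr0 // => -[/andP[]]; rewrite leNgt z0.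
  have [sz|sz] := leP 0 (s - z); last first.
    by rewrite !mulr0 memNset ?mulr0 // => -[/andP[_]]; lra.
  rewrite /pos_root !max_l // -expRD mulrC; congr (expR _ * _); first by ring.
  congr (_%:R); congr nat_of_bool; apply/idP/idP => [tz|].
    by rewrite inE; split => //; rewrite z0; lra.
  by rewrite inE => -[].
Qed.

Lemma weibull_transfer (nu : {sigma_finite_measure set R -> \bar R}) x a y t :
  nu setT = 1%E ->
  (forall A, measurable A ->
     nu A = (\int[mu]_(y in A) (weibull_pdf p y)%:E)%E) ->
  0 < y -> y <= a -> a <= x ->
  (weighted_tail nu [:: x `^ q^-1; y `^ q^-1]%R t <=
   weighted_tail nu [:: a `^ q^-1; (x + y - a) `^ q^-1]%R t)%E.
Proof.
move=> nuT nuE y0 ya ax.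
have [x0 a0 b0] : [/\ 0 <= x, 0 <= a & 0 <= x + y - a] by split; lra.
have [Psi [mPsi Psi0 -> PsiE]] := weighted_tail_segment t nuT nuE x0 (ltW y0).
have [Phi [mPhi Phi0 -> PhiE]] := weighted_tail_segment t nuT nuE a0 b0.
apply: ge0_le_integral => //.
- by move=> s _; exact: integral_ge0.
- exact: measurable_integral_snd.
- exact: measurable_integral_snd.
- move=> s _; rewrite PsiE PhiE.
  apply: lee_wpmul2l; last exact: segment_measure_le.
  by rewrite lee_fin expR_ge0.
Qed.

End weibull_transfer.

(** * Comparison of weighted sums of n variables in both cases *)

Theorem corollary2 (R : realType) (p q : R) (n : nat)
    (hp : 1 < p) (hq : p^-1 + q^-1 = 1) (hn : (1 <= n)%N)
    (d : measure_display) (T : measurableType d) (P : probability T R)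
    (Y : 'I_n -> {RV P >-> R})
    (hY : iid_with_density Y (weibull_pdf p) \/
          [/\ p = 2, q = 2 &
              exists nu : R, 1 <= nu /\ iid_generalized_rayleigh Y nu])
    (a b : 'I_n -> R) (ha : forall i, 0 < a i) (hb : forall i, 0 < b i) :
  majorized (fun i => a i `^ q) (fun i => b i `^ q) ->
  st_le (P := P) (P' := P) (\sum_(i < n) b i *: Y i) (\sum_(i < n) a i *: Y i).
Proof.
move=> maj t.
have q0 : 0 < q.
  rewrite -invr_gt0; have : p^-1 < 1 by rewrite invf_lt1; lra.
  lra.
pose i0 := Ordinal hn.
have [nu [nuT lawY0]] : exists nu : {sigma_finite_measure set R -> \bar R},
    nu setT = 1%E /\ forall A, distribution P (Y i0) A = nu A.
  by exists (distribution P (Y i0)); split => //; exact: probability_setT.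
have [indY nuE transfer] : [/\ mutually_independent Y,
    forall i A, measurable A -> distribution P (Y i) A = nu A &
    forall (x y z u : R), 0 < z -> z <= y -> y <= x ->
      (weighted_tail nu [:: x `^ q^-1; z `^ q^-1]%R u <=
       weighted_tail nu [:: y `^ q^-1; (x + z - y) `^ q^-1]%R u)%E].
  have lawE (f : R -> R) : (forall i, has_density (Y i) f) ->
      [/\ forall i A, measurable A -> distribution P (Y i) A = nu A,
          measurable_fun setT f, forall y, 0 <= f y &
          forall A, measurable A ->
            nu A = (\int[lebesgue_measure]_(y in A) (f y)%:E)%E].
    move=> Yf; have [mf f0 Y0f] := Yf i0.
    have nuf A : measurable A ->
        nu A = (\int[lebesgue_measure]_(y in A) (f y)%:E)%E.
      by move=> mA; rewrite -lawY0; exact: Y0f.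
    by split => // i A mA; have [_ _ Yif] := Yf i; rewrite nuf //; exact: Yif.
  case: hY => [[indY Yf]|[_ q2 [v [v1 [c [indY Yf]]]]]].
    have [nuE _ _ nuf] := lawE _ Yf.
    split; [exact: indY|exact: nuE|move=> x y z u].
    exact: (weibull_transfer hp hq u nuT nuf).
  have [nuE mf f0 nuf] := lawE _ Yf.
  split; [exact: indY|exact: nuE|move=> x y z u; rewrite q2].
  exact: (rayleigh_transfer u v1 mf f0 nuf).
(* The tail as a function of the q-th powers of the weights, the quantities that majorization
   compares. *)
pose Phi s := weighted_tail nu [seq x `^ q^-1 | x <- s] t.
have PhiE (c : 'I_n -> R) : (forall i, 0 < c i) ->
    ccdf (\sum_(i < n) c i *: Y i : {RV P >-> R}) t =
    Phi (rev (increasing_rearrangement (fun i => c i `^ q))).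
  move=> c0; rewrite (ccdf_weighted_sum c indY t (index_enum_uniq _) nuE).
  apply: weighted_tail_perm.
  have rearr : perm_eq (rev (increasing_rearrangement (fun i => c i `^ q)))
      [seq c i `^ q | i <- index_enum 'I_n].
    rewrite perm_rev perm_sort codomE perm_map //.
    apply: uniq_perm; [exact: enum_uniq|exact: index_enum_uniq|move=> i].
    by rewrite mem_enum mem_index_enum.
  rewrite perm_sym; apply: (perm_trans (perm_map _ rearr)); rewrite -map_comp.
  rewrite (eq_map (g := c)) // => i /=.
  by rewrite -powRrM divff ?gt_eqF // powRr1 // ltW.
have pow0 (c : 'I_n -> R) : (forall i, 0 < c i) ->
    all (> 0) (rev (increasing_rearrangement (fun i => c i `^ q))).
  move=> c0; rewrite all_rev all_sort; apply/allP => _ /codomP[i ->].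
  exact: powR_gt0.
rewrite !PhiE //.
(* The induction starts with an empty prefix of settled entries. *)
rewrite -[X in (Phi X <= _)%E]cat0s -[X in (_ <= Phi X)%E]cat0s.
apply: (dominated_le (Phi := Phi)).
- by move=> s s' ss'; apply: weighted_tail_perm; exact: perm_map.
- move=> r x y z r0 z0 zy yx; rewrite /Phi !map_cat.
  by apply: weighted_tail_cat_le => u; exact: transfer.
- by rewrite rev_sorted; apply: sort_sorted; exact: le_total.
- exact: pow0.
- by [].
- exact: majorized_dominated.
Qed.
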